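(* Let $r(w)$ denote the radius of the Square Root Spiral at total rotation angle $w \ge 0$ (in radians), and let $a(w) := r(w+2\pi) - r(w)$ be the distance between two successive winds of the spiral at angle $w$. Then $$\lim_{w\to\infty} a(w) = \pi .$$
   Context: The Square Root Spiral (spiral of Theodorus) is built from right-angled triangles with a common vertex $O$ (the center). For $n \ge 1$ the $n$-th triangle has legs (cathets) of lengths $\sqrt{n}$ and $1$, hence hypotenuse $\sqrt{n+1}$; its right angle is at the end away from $O$ of the leg of length $\sqrt n$, and its angle at $O$ is $t_n = \arctan(1/\sqrt{n})$. The leg of length $\sqrt{n+1}$ of the $(n+1)$-th triangle is the hypotenuse of the $n$-th triangle, and all triangles are attached in the same rotational direction, with the total angle counted cumulatively (not reduced modulo $2\pi$). Put $w(k) = \sum_{n=1}^{k} t_n$ for integers $k \ge 0$ (so $w(0)=0$); $w(k)$ is the angle between the first ray (of length $1$) and the $(k+1)$-th ray (of length $\sqrt{k+1}$). The spiral itself is the polygonal curve formed by the outer legs of length $1$. For real $w\ge 0$, $r(w)$ is the distance from $O$ to the point of this polygonal curve at cumulative angle $w$; in particular $r(w(k)) = \sqrt{k+1}$. Explicitly, for $w(n-1) \le w \le w(n)$ with $n\ge 1$, $r(w) = \sqrt{n}/\cos(w - w(n-1))$. *)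

(* Defs.v *)
From Stdlib Require Import Reals Lra Lia ClassicalEpsilon.
From Coquelicot Require Import Coquelicot.
Open Scope R_scope.

Definition triangle_angle (n : nat) : R := atan (1 / sqrt (INR n)).

(* [sum_n_m u 1 0 = 0], so [total_angle 0 = 0]. *)
Definition total_angle (k : nat) : R := sum_n_m triangle_angle 1 k.

(* The plane is [C], with the center of the spiral at [0] and the first ray
   along the positive real axis. *)
Definition polar (rho theta : R) : C := (rho * cos theta, rho * sin theta).

(* Outer end of the (k+1)-th ray: the (k+1)-th triangle is
   [0, vertex k, vertex (S k)], with its right angle at [vertex k]. *)
Definition vertex (k : nat) : C := polar (sqrt (INR (S k))) (total_angle k).

Definition on_segment (A B p : C) : Prop :=
  exists s : R, 0 <= s <= 1 /\ p = Cplus (Cmult (RtoC (1 - s)) A) (Cmult (RtoC s) B).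

(* [p] is the point of the polygonal curve at cumulative angle [w].  Since [w]
   is not reduced modulo [2 * PI], it is the requirement that [w] lie in the
   angular range of a triangle that selects the right wind of the spiral. *)
Definition spiral_point (w : R) (p : C) : Prop :=
  exists k : nat,
    total_angle k <= w <= total_angle (S k) /\
    on_segment (vertex k) (vertex (S k)) p /\
    p = polar (Cmod p) w.

(* Meaningful for [0 <= w] only: see [spiral_point_exists],
   [spiral_point_unique] and [radius_sector] below. *)
Definition radius (w : R) : R := Cmod (epsilon (inhabits (RtoC 0)) (spiral_point w)).

Definition wind_distance (w : R) : R := radius (w + 2 * PI) - radius w.

Lemma total_angle_0 : total_angle 0 = 0.
Proof. unfold total_angle. rewrite sum_n_m_zero; [reflexivity | lia]. Qed.

Lemma total_angle_S k :
  total_angle (S k) = total_angle k + triangle_angle (S k).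
Proof. unfold total_angle. rewrite sum_n_Sm; [reflexivity | lia]. Qed.

Lemma sqrt_INR_S_pos k : 0 < sqrt (INR (S k)).
Proof. apply sqrt_lt_R0, lt_0_INR. lia. Qed.

Lemma triangle_angle_bounds k : 0 < triangle_angle (S k) < PI / 2.
Proof.
  unfold triangle_angle. split.
  - rewrite <- atan_0. apply atan_increasing.
    apply Rdiv_lt_0_compat; [lra | apply sqrt_INR_S_pos].
  - apply atan_bound.
Qed.

Lemma hypotenuse_cos k :
  sqrt (INR (S (S k))) * cos (triangle_angle (S k)) = sqrt (INR (S k)).
Proof.
  unfold triangle_angle. rewrite cos_atan.
  pose proof (sqrt_INR_S_pos k) as H. pose proof (sqrt_INR_S_pos (S k)) as H'.
  assert (Hs : sqrt (INR (S k)) * sqrt (INR (S k)) = INR (S k))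
    by (apply sqrt_sqrt, pos_INR).
  assert (0 < INR (S k)) by (apply lt_0_INR; lia).
  replace (1 + (1 / sqrt (INR (S k)))²) with (INR (S (S k)) / INR (S k)).
  - rewrite sqrt_div_alt by assumption. field. lra.
  - unfold Rsqr. rewrite (S_INR (S k)).
    replace (1 / sqrt (INR (S k)) * (1 / sqrt (INR (S k))))
      with (1 / (sqrt (INR (S k)) * sqrt (INR (S k)))) by (field; lra).
    rewrite Hs. field. lra.
Qed.

Lemma hypotenuse_sin k :
  sqrt (INR (S (S k))) * sin (triangle_angle (S k)) = 1.
Proof.
  pose proof (hypotenuse_cos k) as Hc. pose proof (sqrt_INR_S_pos k) as H.
  assert (Ht : tan (triangle_angle (S k)) = 1 / sqrt (INR (S k)))
    by apply tan_atan.
  destruct (triangle_angle_bounds k) as [H1 H2].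
  assert (0 < cos (triangle_angle (S k))) by (apply cos_gt_0; lra).
  replace (sin (triangle_angle (S k)))
    with (tan (triangle_angle (S k)) * cos (triangle_angle (S k)))
    by (unfold tan; field; lra).
  rewrite Ht, <- Hc. field. split; [lra | apply Rgt_not_eq, sqrt_INR_S_pos].
Qed.

Lemma total_angle_lt j k : (j < k)%nat -> total_angle j < total_angle k.
Proof.
  induction 1 as [|k _ IH]; rewrite total_angle_S.
  - pose proof (triangle_angle_bounds j). lra.
  - pose proof (triangle_angle_bounds k). lra.
Qed.

Lemma total_angle_ge k : INR k / sqrt (INR (S k)) <= total_angle k.
Proof.
  induction k as [|k IH].
  - rewrite total_angle_0. simpl (INR 0). lra.
  - rewrite total_angle_S.
    pose proof (hypotenuse_sin k) as Hs.
    pose proof (triangle_angle_bounds k) as [Ht _].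
    pose proof (sin_lt_x _ Ht) as Hl.
    pose proof (sqrt_INR_S_pos k). pose proof (sqrt_INR_S_pos (S k)).
    assert (sqrt (INR (S k)) <= sqrt (INR (S (S k))))
      by (apply sqrt_le_1_alt; rewrite (S_INR (S k)); lra).
    assert (E : sin (triangle_angle (S k)) = / sqrt (INR (S (S k)))).
    { apply Rmult_eq_reg_l with (sqrt (INR (S (S k)))); [|lra].
      rewrite Hs. field. lra. }
    assert (INR k / sqrt (INR (S (S k))) <= INR k / sqrt (INR (S k))).
    { apply Rmult_le_compat_l; [apply pos_INR|]. apply Rinv_le_contravar; lra. }
    replace (INR (S k) / sqrt (INR (S (S k))))
      with (INR k / sqrt (INR (S (S k))) + / sqrt (INR (S (S k))))
      by (rewrite (S_INR k); field; lra).
    lra.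
Qed.

Lemma sector_exists w :
  0 <= w -> exists k, total_angle k <= w <= total_angle (S k).
Proof.
  intros Hw.
  assert (Hub : exists m, w <= total_angle m).
  { destruct (INR_unbounded ((w + 1) * (w + 1))) as [m Hm]. exists m.
    eapply Rle_trans; [|apply total_angle_ge].
    pose proof (sqrt_INR_S_pos m) as Hp.
    assert (Hs : sqrt (INR (S m)) * sqrt (INR (S m)) = INR (S m))
      by (apply sqrt_sqrt, pos_INR).
    rewrite S_INR in *. set (q := sqrt (INR m + 1)) in *.
    apply Rmult_le_reg_r with q; [exact Hp|].
    replace (INR m / q * q) with (q * q - 1) by (rewrite Hs; field; lra).
    assert (w + 1 <= q) by nra. nra. }
  destruct Hub as [m Hm]. induction m as [|m IH].
  - exists 0%nat. pose proof (total_angle_lt 0 1 ltac:(lia)).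
    rewrite total_angle_0 in *. lra.
  - destruct (Rle_dec w (total_angle m)) as [H|H]; [auto|].
    exists m. lra.
Qed.

Lemma sector_cos_pos k w :
  total_angle k <= w <= total_angle (S k) -> 0 < cos (w - total_angle k).
Proof.
  rewrite total_angle_S. intros H. pose proof (triangle_angle_bounds k).
  pose proof PI_RGT_0. apply cos_gt_0; lra.
Qed.

Lemma Cmod_polar rho theta : 0 <= rho -> Cmod (polar rho theta) = rho.
Proof.
  intros H. unfold Cmod, polar; simpl.
  replace (_ + _) with (Rsqr rho).
  - apply sqrt_Rsqr, H.
  - pose proof (sin2_cos2 theta). unfold Rsqr in *. nra.
Qed.

Lemma leg_radius k w p :
  total_angle k <= w <= total_angle (S k) ->
  on_segment (vertex k) (vertex (S k)) p -> p = polar (Cmod p) w ->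
  Cmod p = sqrt (INR (S k)) / cos (w - total_angle k).
Proof.
  intros Hw [s [_ Hs]] Hp. pose proof (sector_cos_pos k w Hw) as Hc.
  rewrite Hp in Hs at 1. unfold vertex, polar in Hs.
  rewrite total_angle_S in Hs.
  unfold Cplus, Cmult, RtoC in Hs; cbn [fst snd] in Hs.
  pose proof (f_equal fst Hs) as Hx. pose proof (f_equal snd Hs) as Hy.
  cbn [fst snd] in Hx, Hy.
  rewrite cos_plus, sin_plus in Hx, Hy.
  apply Rmult_eq_reg_r with (cos (w - total_angle k)); [|lra].
  replace (sqrt (INR (S k)) / cos (w - total_angle k) * cos (w - total_angle k))
    with (sqrt (INR (S k))) by (field; lra).
  rewrite cos_minus.
  pose proof (hypotenuse_cos k) as Hh.
  pose proof (sin2_cos2 (total_angle k)) as H1. unfold Rsqr in H1.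
  set (c := cos (total_angle k)) in *. set (d := sin (total_angle k)) in *.
  set (q := sqrt (INR (S (S k)))) in *. set (q0 := sqrt (INR (S k))) in *.
  set (u := cos (triangle_angle (S k))) in *.
  set (v := sin (triangle_angle (S k))) in *.
  transitivity ((Cmod p * cos w) * c + (Cmod p * sin w) * d); [ring|].
  rewrite Hx, Hy.
  transitivity ((d * d + c * c) * ((1 - s) * q0 + s * (q * u))); [ring|].
  rewrite H1, Hh. ring.
Qed.

Lemma spiral_point_exists w : 0 <= w -> exists p, spiral_point w p.
Proof.
  intros Hw. destruct (sector_exists w Hw) as [k Hk].
  pose proof (sector_cos_pos k w Hk) as Hc. pose proof (sqrt_INR_S_pos k) as Hq.
  set (rho := sqrt (INR (S k)) / cos (w - total_angle k)).
  assert (Hr : 0 <= rho) by (left; apply Rdiv_lt_0_compat; assumption).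
  exists (polar rho w), k. split; [exact Hk|].
  split; [|rewrite Cmod_polar by exact Hr; reflexivity].
  pose proof (hypotenuse_cos k) as Hh. pose proof (hypotenuse_sin k) as Hv.
  pose proof (triangle_angle_bounds k) as Ht. pose proof PI_RGT_0.
  exists (rho * sin (w - total_angle k)).
  rewrite total_angle_S in Hk.
  assert (Ew : w = total_angle k + (w - total_angle k)) by ring.
  set (x := w - total_angle k) in *.
  assert (E : rho * sin x = sqrt (INR (S k)) * tan x)
    by (unfold rho, tan; field; lra).
  split; [split|].
  - apply Rmult_le_pos; [exact Hr|]. apply sin_ge_0; unfold x; lra.
  - rewrite E.
    assert (Htan : tan x <= tan (triangle_angle (S k))).
    { destruct (Req_dec x (triangle_angle (S k))) as [->|Hne]; [lra|].
      left. apply tan_increasing; unfold x in *; lra. }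
    unfold triangle_angle in Htan. rewrite tan_atan in Htan.
    replace 1 with (sqrt (INR (S k)) * (1 / sqrt (INR (S k)))) by (field; lra).
    apply Rmult_le_compat_l; lra.
  - assert (E' : rho * cos x = sqrt (INR (S k))) by (unfold rho; field; lra).
    unfold vertex, polar. rewrite total_angle_S, Ew.
    rewrite !cos_plus, !sin_plus.
    set (s := rho * sin x) in *.
    set (c := cos (total_angle k)) in *. set (d := sin (total_angle k)) in *.
    unfold Cplus, Cmult, RtoC; cbn [fst snd]. f_equal.
    + transitivity ((rho * cos x) * c - s * d); [unfold s; ring|].
      rewrite E'. rewrite <- Hh at 1.
      transitivity ((1 - s) * (sqrt (INR (S k)) * c)
        + s * (c * (sqrt (INR (S (S k))) * cos (triangle_angle (S k)))
             - d * (sqrt (INR (S (S k))) * sin (triangle_angle (S k))))); [|ring].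
      rewrite Hh, Hv. ring.
    + transitivity ((rho * cos x) * d + s * c); [unfold s; ring|].
      rewrite E'.
      transitivity ((1 - s) * (sqrt (INR (S k)) * d)
        + s * (d * (sqrt (INR (S (S k))) * cos (triangle_angle (S k)))
             + c * (sqrt (INR (S (S k))) * sin (triangle_angle (S k))))); [|ring].
      rewrite Hh, Hv. ring.
Qed.

Lemma sector_radius_eq j k w :
  total_angle j <= w <= total_angle (S j) ->
  total_angle k <= w <= total_angle (S k) ->
  sqrt (INR (S j)) / cos (w - total_angle j)
  = sqrt (INR (S k)) / cos (w - total_angle k).
Proof.
  assert (Hlt : forall j k, (j < k)%nat ->
    total_angle j <= w <= total_angle (S j) ->
    total_angle k <= w <= total_angle (S k) ->
    sqrt (INR (S j)) / cos (w - total_angle j)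
    = sqrt (INR (S k)) / cos (w - total_angle k)).
  { clear j k. intros j k Hjk Hj Hk.
    destruct (Nat.eq_dec k (S j)) as [->|Hne].
    - pose proof (sector_cos_pos j w Hj) as Hc.
      assert (w = total_angle (S j)) by lra. subst w.
      rewrite Rminus_diag, cos_0, Rdiv_1_r.
      rewrite total_angle_S in *.
      replace (total_angle j + triangle_angle (S j) - total_angle j)
        with (triangle_angle (S j)) in * by ring.
      rewrite <- (hypotenuse_cos j). field. lra.
    - pose proof (total_angle_lt (S j) k ltac:(lia)). lra. }
  intros Hj Hk. destruct (Nat.lt_trichotomy j k) as [H|[->|H]].
  - now apply Hlt.
  - reflexivity.
  - symmetry. now apply Hlt.
Qed.

Lemma spiral_point_unique w p q : spiral_point w p -> spiral_point w q -> p = q.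
Proof.
  intros [j [Hj [Sj Pj]]] [k [Hk [Sk Pk]]].
  rewrite Pj, Pk, (leg_radius j w p), (leg_radius k w q) by assumption.
  now rewrite (sector_radius_eq j k w).
Qed.

(* On the (k+1)-th triangle the radius is [sqrt (k+1) / cos (w - w(k))]. *)
Lemma radius_sector k w :
  total_angle k <= w <= total_angle (S k) ->
  radius w = sqrt (INR (S k)) / cos (w - total_angle k).
Proof.
  intros Hk.
  assert (Hw : 0 <= w).
  { destruct k as [|k]; [rewrite total_angle_0 in *; lra|].
    pose proof (total_angle_lt 0 (S k) ltac:(lia)).
    rewrite total_angle_0 in *. lra. }
  unfold radius.
  pose proof (epsilon_spec (inhabits (RtoC 0)) _ (spiral_point_exists w Hw)) as Hp.
  destruct Hp as [j [Hj [Sj Pj]]].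
  rewrite (leg_radius j w _ Hj Sj Pj). now apply sector_radius_eq.
Qed.

(* Main.v *)
Require Import Defs.
From Stdlib Require Import Reals.
From Coquelicot Require Import Coquelicot.
From Stdlib Require Import Lra Lia.
Open Scope R_scope.

(** On the ray of length [q] and the next one of length [q'], both the growth of
    the radius and the growth of the angle are controlled by the angle [t] of
    the triangle between them: [q = cot t] and [q' = 1 / sin t], so that
    [q' - q = tan (t / 2)].  Hence twice the radius grows by [2 * tan (t / 2)]
    while the angle grows by [t], which is slightly less.  The excess
    [2 * sqrt (k + 1) - w(k)] therefore increases ([spiral_excess_incr]).  It is
    bounded ([spiral_excess_bounded]), because [t >= sin t = 1 / q'] and
    [1 / sqrt m >= 2 * (sqrt (m + 1) - sqrt m)] telescopes.  So it converges to
    some [l], and since radius and angle vary little within one triangle,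
    [r(w) - w / 2] tends to [l / 2] ([radius_minus_half_angle_lim]): the spiral
    is asymptotic to an Archimedean spiral whose radius grows by one half per
    radian.  A full turn then adds [(2 * PI) / 2 = PI]. *)

(** Indexed from 0, so that ray [k] ends at [vertex k], at angle [total_angle k]. *)
Definition ray (k : nat) : R := sqrt (INR (S k)).

Definition spiral_excess (k : nat) : R := 2 * ray k - total_angle k.

Lemma ray_pos k : 0 < ray k.
Proof. apply sqrt_INR_S_pos. Qed.

Lemma ray_sqr k : ray k * ray k = INR k + 1.
Proof. unfold ray. rewrite sqrt_sqrt by apply pos_INR. apply S_INR. Qed.

Lemma ray_lt_S k : ray k < ray (S k).
Proof.
  apply sqrt_lt_1_alt. split; [apply pos_INR|]. rewrite (S_INR (S k)). lra.
Qed.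

Lemma ray_gap_mult k : (ray (S k) - ray k) * (ray (S k) + ray k) = 1.
Proof.
  pose proof (ray_sqr k) as H. pose proof (ray_sqr (S k)) as H1.
  rewrite S_INR in H1. nra.
Qed.

Lemma atan_le_id y : 0 <= y -> atan y <= y.
Proof.
  intros Hy.
  destruct (MVT_gen atan 0 y (fun x => / (1 + x * x))) as [c [_ Hc]].
  - intros x _. auto_derive; [exact I|]. field. nra.
  - intros x _. apply derivable_continuous_pt, derivable_pt_atan.
  - rewrite atan_0, !Rminus_0_r in Hc. rewrite Hc.
    rewrite <- (Rmult_1_l y) at 2. apply Rmult_le_compat_r; [exact Hy|].
    rewrite <- Rinv_1. apply Rinv_le_contravar; nra.
Qed.

(** Half-angle formula: [1 / sin t - cot t = tan (t / 2)]. *)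
Lemma ray_gap_tan k : ray (S k) - ray k = tan (triangle_angle (S k) / 2).
Proof.
  pose proof (hypotenuse_cos k) as Hc. pose proof (hypotenuse_sin k) as Hs.
  pose proof (triangle_angle_bounds k) as Ht. pose proof PI_RGT_0.
  fold (ray k) (ray (S k)) in *. set (t := triangle_angle (S k)) in *.
  assert (0 < cos (t / 2)) by (apply cos_gt_0; lra).
  replace t with (2 * (t / 2)) in Hc, Hs by field.
  rewrite cos_2a_sin in Hc. rewrite sin_2a in Hs.
  apply Rmult_eq_reg_r with (cos (t / 2)); [|lra].
  unfold tan. replace (sin (t / 2) / cos (t / 2) * cos (t / 2))
    with (sin (t / 2)) by (field; lra).
  rewrite <- Hc.
  transitivity (sin (t / 2) * (ray (S k) * (2 * sin (t / 2) * cos (t / 2))));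
    [ring|].
  rewrite Hs. ring.
Qed.

(** This is [t / 2 <= tan (t / 2)]. *)
Lemma triangle_angle_le_gap k :
  triangle_angle (S k) <= 2 * (ray (S k) - ray k).
Proof.
  pose proof (triangle_angle_bounds k) as Ht.
  pose proof (ray_lt_S k) as Hlt.
  assert (E : triangle_angle (S k) / 2 = atan (ray (S k) - ray k)).
  { rewrite ray_gap_tan, atan_tan; lra. }
  pose proof (atan_le_id (ray (S k) - ray k)). lra.
Qed.

Lemma spiral_excess_incr k : spiral_excess k <= spiral_excess (S k).
Proof.
  unfold spiral_excess. rewrite total_angle_S.
  pose proof (triangle_angle_le_gap k). lra.
Qed.

(** Comes from [t > sin t = 1 / ray (S k)] and the concavity of the square root. *)
Lemma next_gap_le_triangle_angle k :
  2 * (ray (S (S k)) - ray (S k)) <= triangle_angle (S k).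
Proof.
  pose proof (hypotenuse_sin k) as Hs.
  pose proof (triangle_angle_bounds k) as [Ht _].
  pose proof (sin_lt_x _ Ht). fold (ray (S k)) in Hs.
  pose proof (ray_gap_mult (S k)). pose proof (ray_lt_S (S k)).
  pose proof (ray_pos (S k)).
  apply Rmult_le_reg_l with (ray (S k)); [assumption|]. nra.
Qed.

(** Shifting the ray by one index reverses the monotonicity: [2 * ray (S k) -
    total_angle k] decreases and dominates [spiral_excess k]. *)
Lemma spiral_excess_bounded k : spiral_excess k <= 2 * ray 1.
Proof.
  assert (H : 2 * ray (S k) - total_angle k <= 2 * ray 1).
  { induction k as [|k IH].
    - rewrite total_angle_0. lra.
    - rewrite total_angle_S. pose proof (next_gap_le_triangle_angle k). lra. }
  unfold spiral_excess. pose proof (ray_lt_S k). lra.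
Qed.

Lemma ray_gap_lim : is_lim_seq (fun k => ray (S k) - ray k) 0.
Proof.
  apply is_lim_seq_spec. intros eps. pose proof (cond_pos eps) as He.
  destruct (INR_unbounded (/ eps * / eps)) as [N HN].
  exists N. intros k Hk. apply le_INR in Hk.
  pose proof (ray_gap_mult k) as Hm. pose proof (ray_lt_S k).
  pose proof (ray_pos k). pose proof (ray_sqr k).
  rewrite Rminus_0_r, Rabs_pos_eq by lra.
  pose proof (Rinv_0_lt_compat _ He).
  assert (Hr : / eps < ray k) by nra.
  apply Rmult_lt_compat_l with (r := eps) in Hr; [|exact He].
  rewrite Rinv_r in Hr by lra. nra.
Qed.

(** Within one triangle the radius runs between two consecutive rays, and half
    of the angle moves by at most the gap between them. *)
Lemma radius_minus_half_angle_sector k w :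
  total_angle k <= w <= total_angle (S k) ->
  Rabs (radius w - w / 2 - spiral_excess k / 2) <= ray (S k) - ray k.
Proof.
  intros Hw. pose proof (sector_cos_pos k w Hw) as Hc.
  pose proof (triangle_angle_le_gap k) as Hg.
  pose proof (triangle_angle_bounds k) as Ht. pose proof PI_RGT_0.
  pose proof (hypotenuse_cos k) as Hh. fold (ray k) (ray (S k)) in Hh.
  pose proof (ray_pos k). pose proof (ray_pos (S k)).
  pose proof (COS_bound (w - total_angle k)).
  assert (Hr : radius w * cos (w - total_angle k) = ray k).
  { rewrite (radius_sector k w Hw). fold (ray k). field. lra. }
  rewrite total_angle_S in Hw.
  assert (cos (triangle_angle (S k)) <= cos (w - total_angle k))
    by (apply cos_decr_1; lra).
  assert (ray k <= radius w) by nra.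
  assert (radius w <= ray (S k)).
  { apply Rmult_le_reg_r with (cos (w - total_angle k)); nra. }
  unfold spiral_excess. apply Rabs_le. lra.
Qed.

Lemma radius_minus_half_angle_lim :
  exists l : R, is_lim (fun w => radius w - w / 2) p_infty l.
Proof.
  destruct (ex_finite_lim_seq_incr spiral_excess (2 * ray 1)
    spiral_excess_incr spiral_excess_bounded) as [l Hl].
  exists (l / 2). apply is_lim_spec. intros eps.
  apply is_lim_seq_spec in Hl. destruct (Hl (pos_div_2 eps)) as [N1 H1].
  destruct (proj2 (is_lim_seq_spec _ _) ray_gap_lim (pos_div_2 eps)) as [N2 H2].
  exists (total_angle (N1 + N2)). intros w Hw.
  assert (H0 : 0 <= w).
  { pose proof (total_angle_ge (N1 + N2)) as H.
    pose proof (Rdiv_le_0_compat _ _ (pos_INR (N1 + N2)) (ray_pos (N1 + N2))).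
    unfold ray in *. lra. }
  destruct (sector_exists w H0) as [k Hk].
  assert (N1 + N2 <= k)%nat.
  { destruct (Nat.le_gt_cases (N1 + N2) k) as [H|H]; [exact H|].
    destruct (Nat.eq_dec (S k) (N1 + N2)) as [E|E].
    - rewrite E in Hk. lra.
    - pose proof (total_angle_lt (S k) (N1 + N2) ltac:(lia)). lra. }
  specialize (H1 k ltac:(lia)). specialize (H2 k ltac:(lia)).
  apply radius_minus_half_angle_sector in Hk.
  cbn [pos_div_2 pos] in H1, H2.
  pose proof (ray_lt_S k). rewrite Rminus_0_r, Rabs_pos_eq in H2 by lra.
  apply Rabs_def2 in H1. apply Rabs_le_between in Hk.
  apply Rabs_def1; lra.
Qed.

Theorem mainTheorem1 : is_lim wind_distance p_infty PI.
Proof.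
  destruct radius_minus_half_angle_lim as [l Hl].
  apply is_lim_spec. intros eps.
  destruct (proj2 (is_lim_spec _ _ _) Hl (pos_div_2 eps)) as [M HM].
  exists M. intros w Hw. pose proof PI_RGT_0.
  pose proof (HM w Hw) as H1. pose proof (HM (w + 2 * PI) ltac:(lra)) as H2.
  cbn [pos_div_2 pos] in H1, H2.
  apply Rabs_def2 in H1. apply Rabs_def2 in H2.
  unfold wind_distance. apply Rabs_def1; lra.
Qed.
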